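(* Let $\Omega\subset\mathbb{R}^2$ be a bounded domain, let $\mathcal{C}=[-\frac12,\frac12]$ and $\lambda\in\mathbb{C}\setminus\mathcal{C}$. Then for any $N$ (with $\omega^N\neq\emptyset$) the linear system $$\lambda u_m+\frac1\pi N^{-2}\sum_{n\in\omega^N,\,n\neq m}\frac{(x^N_{m,1}-x^N_{n,1})(x^N_{m,2}-x^N_{n,2})}{|x^N_m-x^N_n|^4}\,u_n=f(x^N_m)\qquad(m\in\omega^N)$$ has a unique solution, and, writing the system as $(\lambda I-T^N)U=F$, there is the uniform resolvent estimate $$\|(\lambda I-T^N)^{-1}\|_{\mathcal{L}(\ell^2(\omega^N))}\le\operatorname{dist}(\lambda,\mathcal{C})^{-1}.$$
   Context: For each positive integer $N$ an origin $a^N\in\mathbb{R}^2$ is fixed, $x^N_m=(x^N_{m,1},x^N_{m,2})=a^N+\frac mN$ for $m\in\mathbb{Z}^2$, and $\omega^N=\{m\in\mathbb{Z}^2\mid x^N_m\in\Omega\}$. The right-hand side values $f(x^N_m)$, $m\in\omega^N$, are arbitrary complex numbers. $T^N$ is the matrix with zero diagonal and entries $-\frac1{\pi N^2}\frac{(x^N_{m,1}-x^N_{n,1})(x^N_{m,2}-x^N_{n,2})}{|x^N_m-x^N_n|^4}$ for $m\ne n$ in $\omega^N$. *)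

(* Defs.v *)
From HB Require Import structures.
From mathcomp Require Import all_boot all_order all_algebra finmap.
From mathcomp Require Import complex.
From mathcomp Require Import all_classical all_reals all_analysis.
Set Implicit Arguments. Unset Strict Implicit. Unset Printing Implicit Defensive.
Import Order.TTheory GRing.Theory Num.Theory.
Import numFieldNormedType.Exports.
Local Open Scope classical_set_scope.
Local Open Scope ring_scope.
Local Open Scope complex_scope.

Definition is_domain (R : realType) (Omega : set (R * R)) : Prop :=
  [/\ open Omega, connected Omega & Omega !=set0].

(* The library norm on a product is the max norm, hence an explicit
   Euclidean norm. *)
Definition euclid_norm (R : realType) (x : R * R) : R :=
  Num.sqrt (x.1 ^+ 2 + x.2 ^+ 2).

(* The library norm on R[i] takes its values in R[i]; this one is real. *)
Definition cabs (R : realType) (z : R[i]) : R := ComplexField.Normc.normc z.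

Definition segC (R : realType) : set R[i] :=
  [set t%:C | t in [set t : R | - 2^-1 <= t <= 2^-1]].
Arguments segC R : clear implicits.

Definition cdist (R : realType) (z : R[i]) (A : set R[i]) : R :=
  inf [set cabs (z - w) | w in A].

Definition gridpt (R : realType) (a : nat -> R * R) (N : nat)
    (m : int * int) : R * R :=
  ((a N).1 + m.1%:~R / N%:R, (a N).2 + m.2%:~R / N%:R).

Definition lattice (R : realType) (Omega : set (R * R)) (a : nat -> R * R)
    (N : nat) : set (int * int) :=
  [set m | Omega (gridpt a N m)].

(* fset_set returns the empty set on infinite sets; lattice_finite below shows
   that this default is not used for bounded Omega. *)
Definition omega (R : realType) (Omega : set (R * R)) (a : nat -> R * R)
    (N : nat) : {fset int * int} :=
  fset_set (lattice Omega a N).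

Definition kern (R : realType) (x y : R * R) : R :=
  (x.1 - y.1) * (x.2 - y.2) / euclid_norm (x - y) ^+ 4.

Definition is_solution (R : realType) (Omega : set (R * R))
    (a : nat -> R * R) (N : nat) (lambda : R[i]) (f : R * R -> R[i])
    (u : {ffun omega Omega a N -> R[i]}) : Prop :=
  forall m : omega Omega a N,
    lambda * u m
    + (pi^-1 * N%:R ^- 2)%:C
      * (\sum_(n : omega Omega a N | n != m)
           (kern (gridpt a N (val m)) (gridpt a N (val n)))%:C * u n)
    = f (gridpt a N (val m)).

(* Vectors and matrices indexed by a finite type I are written in
   coordinates through the enumeration enum_val : 'I_#|I| -> I. *)
Definition colvec (R : realType) (I : finType) (u : I -> R[i]) : 'cV[R[i]]_#|I| :=
  \col_i u (enum_val i).

Definition Tmat (R : realType) (Omega : set (R * R)) (a : nat -> R * R)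
    (N : nat) : 'M[R[i]]_#|{: omega Omega a N}| :=
  \matrix_(i, j)
    let m := enum_val i in
    let n := enum_val j in
    if m == n then 0
    else (- (pi * N%:R ^+ 2)^-1
            * kern (gridpt a N (val m)) (gridpt a N (val n)))%:C.

Definition l2norm (R : realType) (k : nat) (v : 'cV[R[i]]_k) : R :=
  Num.sqrt (\sum_i cabs (v i 0) ^+ 2).

Definition opnorm (R : realType) (k : nat) (A : 'M[R[i]]_k) : \bar R :=
  ereal_sup [set (l2norm (A *m v))%:E | v in [set v | l2norm v <= 1]].

Lemma int_interval_finite (K : nat) : finite_set [set k : int | (`|k| <= K)%N].
Proof.
apply: (@sub_finite_set _ _
  ([set Posz n | n in `I_K.+1] `|` [set - Posz n | n in `I_K.+1])).
  by move=> [] n /= nK; [left|right; rewrite NegzE]; [exists n|exists n.+1].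
rewrite finite_setU; split.
  by apply: finite_image; exact: finite_II.
by apply: finite_image; exact: finite_II.
Qed.

Lemma lattice_finite (R : realType) (Omega : set (R * R)) (a : nat -> R * R)
    (N : nat) :
  bounded_set Omega -> (0 < N)%N -> finite_set (lattice Omega a N).
Proof.
move=> /pinfty_ex_gt0[M _ MO] N0.
have N0' : 0 < N%:R :> R by rewrite ltr0n.
pose B (c : R) : nat := Num.trunc (N%:R * (`|M| + `|c|) : R).
have key (c : R) (k : int) : `|c + k%:~R / N%:R| <= M -> (`|k| <= B c)%N.
  move=> h; rewrite /B truncn_ge_nat ?mulr_ge0 ?addr_ge0//.
  have -> : (`|k|%N)%:R = N%:R * `|k%:~R / N%:R| :> R.
    rewrite normrM normfV (ger0_norm (ltW N0')) mulrCA divff ?gt_eqF// mulr1.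
    by rewrite natr_absz intr_norm.
  rewrite ler_pM2l//.
  have -> : k%:~R / N%:R = (c + k%:~R / N%:R) - c :> R by rewrite addrC addKr.
  by rewrite (le_trans (ler_normB _ _))// lerD2r (le_trans h)// ler_norm.
apply: (@sub_finite_set _ _ ([set k : int | (`|k| <= B (a N).1)%N] `*`
                             [set k : int | (`|k| <= B (a N).2)%N])).
  move=> m /MO /=; rewrite prod_normE /= ge_max => /andP[h1 h2].
  by split; apply: key.
by apply: finite_setX; exact: int_interval_finite.
Qed.

Lemma mem_omega (R : realType) (Omega : set (R * R)) (a : nat -> R * R)
    (N : nat) (m : int * int) :
  bounded_set Omega -> (0 < N)%N ->
  (m \in omega Omega a N) <-> Omega (gridpt a N m).
Proof.
move=> bO N0; rewrite /omega in_fset_set ?inE//.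
exact: lattice_finite.
Qed.

(* Main.v *)
(* The entries of T depend on m - n only, and T is real symmetric, so everything
   reduces to |<T x, x>| <= |x|^2 / 2 for real x: then with s the Rayleigh
   quotient of u, (lambda - T) u = (lambda - s) u - (T - s) u is an orthogonal
   decomposition and |(lambda - T) u| >= |lambda - s| |u| >= dist(lambda, C) |u|.

   The form bound says that the symbol of the Toeplitz kernel
   k(a, b) = a b / (a^2 + b^2)^2 is bounded by pi / 2.  For b > 0,
   2 k(a, b) = \int_0^oo t sin(a t) exp(-b t) dt, and the odd extension of
   exp(-|b| t) has the symbol i sin phi / (cosh t - cos phi).  Folding t modulo
   2 pi, the claim becomes
   | sin phi * \sum_(k in Z) (theta + 2 pi k) / (cosh(theta + 2 pi k) - cos phi) |
   <= 1 for 0 < theta, phi < pi.  For k >= 0 the terms are positive, for k < 0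
   negative; ordered by |theta + 2 pi k| they alternate, their absolute values
   decrease beyond pi, and each is at most 1 since
   cos phi + t sin phi <= 1 + t^2 / 2 <= cosh t.

   Fourier integrals are replaced by averages over midpoint grids of (0, pi), on
   which the cosines are exactly orthogonal: delta_0 +- (2 / pi) k is a pointwise
   limit of nonnegative combinations of characters of Z^2. *)
Require Import Defs.
From mathcomp Require Import all_boot all_order all_algebra finmap.
From mathcomp Require Import complex.
From mathcomp Require Import all_classical all_reals all_analysis.
From mathcomp Require Import ring lra zify.
Import Order.TTheory GRing.Theory Num.Theory.
Import numFieldNormedType.Exports.
Local Open Scope classical_set_scope.
Local Open Scope ring_scope.

(** * The bound on the folded symbol *)

Definition ch {R : realType} (t : R) : R := (expR t + expR (- t)) / 2.
Definition sh {R : realType} (t : R) : R := (expR t - expR (- t)) / 2.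

Lemma expRN_id (R : realType) (t : R) : expR t * expR (- t) = 1.
Proof. by rewrite -expRD subrr expR0. Qed.

Lemma sh_ge_id (R : realType) (t : R) : 0 <= t -> t <= sh t.
Proof.
move=> t0; pose f (u : R) := expR u - expR (- u) - 2 * u.
have df (u : R) : is_derive u 1 f (expR u + expR (- u) - 2).
  rewrite /f; apply: is_derive_eq.
  by rewrite /GRing.scale /=; ring.
have : f 0 <= f t.
  apply: (@ger0_derive1_ndecry _ f 0) => //.
  - move=> u _; rewrite derive1E (@derive_val _ _ _ _ _ _ _ (df u)).
    have := expRN_id R u; have := expR_gt0 u; have := expR_gt0 (- u).
    set p := expR u; set q := expR (- u) => q0 p0 pq.
    have := sqr_ge0 (p - q); nra.
  - apply: continuous_subspaceT => u.
    by apply: differentiable_continuous; apply/derivable1_diffP.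
rewrite /f oppr0 subrr mulr0 subr0 /sh; lra.
Qed.

(** Half-angle: [ch t = 1 + 2 * sh (t / 2) ^+ 2], and [sh (t / 2) >= t / 2]. *)
Lemma ch_ge (R : realType) (t : R) : 0 <= t -> 1 + t ^+ 2 / 2 <= ch t.
Proof.
move=> t0; have := @sh_ge_id R (t / 2); rewrite /sh /ch => /(_ ltac:(lra)).
have -> : expR t = expR (t / 2) ^+ 2 by rewrite -expRM_natl; congr expR; field.
have -> : expR (- t) = expR (- (t / 2)) ^+ 2.
  by rewrite -expRM_natl; congr expR; field.
have := expRN_id R (t / 2).
move: (expR (t / 2)) (expR (- (t / 2))) => p q pq h.
nra.
Qed.

Lemma ch_tangent (R : realType) (s t : R) : ch s + (t - s) * sh s <= ch t.
Proof.
have h1 := expR_ge1Dx (t - s); have h2 := expR_ge1Dx (- (t - s)).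
have -> : ch t = (expR s * expR (t - s) + expR (- s) * expR (- (t - s))) / 2.
  by rewrite -!expRD /ch; congr ((expR _ + expR _) / 2); ring.
rewrite /ch /sh.
have := expR_gt0 s; have := expR_gt0 (- s) => p q.
have := ler_wpM2l (ltW q) h1; have := ler_wpM2l (ltW p) h2; lra.
Qed.

(** For [c = cos phi], [sin phi] times this is, up to the factor i, [t] times the symbol of the odd
    extension of exp(-b t). *)
Definition cosh_ratio {R : realType} (c t : R) : R := t / (ch t - c).

Lemma ch_sub_gt0 (R : realType) (c t : R) : c <= 1 -> 0 < t -> 0 < ch t - c.
Proof. by move=> c1 t0; have := @ch_ge R t (ltW t0); nra. Qed.

Lemma cosh_ratio_ge0 (R : realType) (c t : R) : c <= 1 -> 0 < t -> 0 <= cosh_ratio c t.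
Proof. by move=> c1 t0; rewrite divr_ge0 ?ltW// ch_sub_gt0. Qed.

Lemma cosh_ratio_le1 (R : realType) (phi t : R) : 0 < t ->
  sin phi * cosh_ratio (cos phi) t <= 1.
Proof.
move=> t0; have h : 0 < ch t - cos phi by rewrite ch_sub_gt0 ?cos_le1.
rewrite mulrA ler_pdivrMr// mul1r.
have := @ch_ge R t (ltW t0); have := cos2Dsin2 phi.
have := cos_le1 phi; move: (cos phi) (sin phi) => c s c1 cs ht.
(* Gives [t s <= t^2 / 2 + (1 - c^2) / 2], and [(1 - c^2) / 2 <= 1 - c]. *)
have := sqr_ge0 (t - s); nra.
Qed.

(** The tangent to [ch] at [s] gives [t * (ch s - c) <= s * (ch t - c)] as soon as
    [ch s - c <= s * sh s]; from [s = 2] on this follows from [expR s >= 4]. *)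
Lemma cosh_ratio_decr (R : realType) (c s t : R) : -1 <= c -> c <= 1 -> 2 <= s ->
  s <= t -> cosh_ratio c t <= cosh_ratio c s.
Proof.
move=> c0 c1 s2 st.
have hs : 0 < ch s - c by apply: ch_sub_gt0 => //; lra.
have ht : 0 < ch t - c by apply: ch_sub_gt0 => //; lra.
rewrite /cosh_ratio ler_pdivrMr// mulrAC ler_pdivlMr//.
have H : ch s - c <= s * sh s.
  have e4 : 4 <= expR s.
    have -> : expR s = expR (s / 2) ^+ 2 by rewrite -expRM_natl; congr expR; field.
    by have := expR_ge1Dx (s / 2); nra.
  have := expRN_id R s; have := expR_gt0 (- s).
  rewrite /ch /sh; move: (expR s) (expR (- s)) e4 => p q p4 q0 pq.
  have q1 : q <= 4^-1 by nra.
  nra.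
have := ch_tangent R s t; nra.
Qed.

(** The two ways of pairing neighbouring terms put the sum over [k] between [- g (2 * pi - theta)]
    and [0], and [sin phi * g] is at most 1 at [theta] and at [2 * pi - theta]. *)
Lemma alternating_sum_bound (R : realType) (phi theta : R) (K : nat) :
  0 < phi < pi -> 0 < theta < pi ->
  `|sin phi * (cosh_ratio (cos phi) theta + \sum_(k < K)
      (cosh_ratio (cos phi) (k.+1%:R * (2 * pi) + theta)
       - cosh_ratio (cos phi) (k.+1%:R * (2 * pi) - theta)))| <= 1.
Proof.
move=> hphi /andP[th0 thpi]; have s0 := sin_gt0_pi hphi.
have p2 := pi_ge2 R.
have c1 := cos_le1 phi; have c0 := cos_geN1 phi.
have k0 (k : nat) : 0 <= k%:R :> R by [].
have S1 k : (k.+1%:R = k%:R + 1 :> R) by rewrite -natr1.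
set g := cosh_ratio _.
have F1 : sin phi * g (theta) <= 1 by apply: cosh_ratio_le1.
have up : \sum_(k < K) (g (k.+1%:R * (2 * pi) + theta)
    - g (k.+1%:R * (2 * pi) - theta)) <= 0.
  elim/big_ind : _ => // [x y ? ?|k _]; first lra.
  rewrite subr_le0; apply: cosh_ratio_decr => //; rewrite S1; have := k0 k; nra.
have lo : - g (2 * pi - theta) <= \sum_(k < K) (g (k.+1%:R * (2 * pi) + theta)
    - g (k.+1%:R * (2 * pi) - theta)).
  (* The first [g] is the next term to be subtracted; keeping it closes the induction on [K]. *)
  suff : g (K%:R * (2 * pi) + (2 * pi - theta)) - g (2 * pi - theta) <=
      \sum_(k < K) (g (k.+1%:R * (2 * pi) + theta)
        - g (k.+1%:R * (2 * pi) - theta)).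
    have : 0 <= g (K%:R * (2 * pi) + (2 * pi - theta)).
      by apply: cosh_ratio_ge0 => //; have := k0 K; nra.
    lra.
  elim: K {up} => [|K IH]; first by rewrite big_ord0 mul0r add0r subrr.
  rewrite big_ord_recr /=.
  have e1 : K.+1%:R * (2 * pi) - theta = K%:R * (2 * pi) + (2 * pi - theta) :> R.
    by rewrite S1; ring.
  rewrite e1.
  have : g (K.+1%:R * (2 * pi) + (2 * pi - theta)) <= g (K.+1%:R * (2 * pi) + theta).
    by apply: cosh_ratio_decr => //; rewrite S1; have := k0 K; nra.
  lra.
have F2 : sin phi * g (2 * pi - theta) <= 1 by apply: cosh_ratio_le1; lra.
have g0 : 0 <= g theta by apply: cosh_ratio_ge0.
by rewrite ler_norml; apply/andP; split; nra.
Qed.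

(** * Positive definite functions on Z^2 *)

(** Real coefficients suffice: real and imaginary parts of a vector are estimated separately in the
    end. *)
Definition psd {R : realType} (c : int -> int -> R) : Prop :=
  forall (I : finType) (p : I -> int * int) (x : I -> R),
    0 <= \sum_(m : I) \sum_(n : I)
           c ((p m).1 - (p n).1) ((p m).2 - (p n).2) * (x m * x n).

Lemma psd_ext (R : realType) (c d : int -> int -> R) :
  (forall a b, c a b = d a b) -> psd c -> psd d.
Proof. by move=> cd; have -> : c = d by apply/funext => a; apply/funext => b. Qed.

(** The form is the squared modulus of the sum of [x m] times exp(i [xi m]). *)
Lemma psd_cos (R : realType) (theta phi : R) :
  psd (fun a b => cos (a%:~R * theta + b%:~R * phi)).
Proof.
move=> I p x; pose xi m : R := (p m).1%:~R * theta + (p m).2%:~R * phi.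
have -> : \sum_m \sum_n cos (((p m).1 - (p n).1)%:~R * theta
      + ((p m).2 - (p n).2)%:~R * phi) * (x m * x n) =
    (\sum_m cos (xi m) * x m) ^+ 2 + (\sum_m sin (xi m) * x m) ^+ 2.
  rewrite !expr2 !big_distrlr /= -big_split /=; apply: eq_bigr => m _.
  rewrite -big_split /=; apply: eq_bigr => n _.
  have -> : ((p m).1 - (p n).1)%:~R * theta + ((p m).2 - (p n).2)%:~R * phi
     = xi m - xi n by rewrite /xi !intrB; ring.
  by rewrite cosB; ring.
by rewrite addr_ge0 ?sqr_ge0.
Qed.

Lemma psd_add (R : realType) (c d : int -> int -> R) :
  psd c -> psd d -> psd (fun a b => c a b + d a b).
Proof.
move=> hc hd I p x; apply: le_trans (addr_ge0 (hc I p x) (hd I p x)) _.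
rewrite -big_split /=; apply: ler_sum => m _.
by rewrite -big_split /=; apply: ler_sum => n _; rewrite mulrDl.
Qed.

Lemma psd_scale (R : realType) (r : R) (c : int -> int -> R) :
  0 <= r -> psd c -> psd (fun a b => r * c a b).
Proof.
move=> r0 hc I p x; apply: le_trans (mulr_ge0 r0 (hc I p x)) _.
rewrite mulr_sumr; apply: ler_sum => m _.
by rewrite mulr_sumr; apply: ler_sum => n _; rewrite -mulrA.
Qed.

Lemma psd_sum (R : realType) (k : nat) (c : 'I_k -> int -> int -> R) :
  (forall i, psd (c i)) -> psd (fun a b => \sum_(i < k) c i a b).
Proof.
elim: k c => [|k IH] c hc.
  by move=> I p x; rewrite big1// => m _; rewrite big1// => n _; rewrite big_ord0 mul0r.
apply: (@psd_ext R (fun a b => \sum_(i < k) c (widen_ord (leqnSn k) i) a b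
   + c ord_max a b)) => [a b|]; first by rewrite big_ord_recr.
by apply: psd_add => //; apply: IH => i.
Qed.

(** A combination of two cosines with weights [(1 + s) / 2] and [(1 - s) / 2], nonnegative exactly
    when [|s| <= 1]: here a bound by 1 on a symbol becomes positivity. *)
Lemma psd_cos_sin (R : realType) (theta phi s : R) : `|s| <= 1 ->
  psd (fun a b => cos (a%:~R * theta) * cos (b%:~R * phi)
    + s * (sin (a%:~R * theta) * sin (b%:~R * phi))).
Proof.
rewrite ler_norml => /andP[s0 s1].
apply: (@psd_ext R (fun a b : int =>
    ((1 + s) / 2) * cos (a%:~R * theta + b%:~R * (- phi))
  + ((1 - s) / 2) * cos (a%:~R * theta + b%:~R * phi))).
  by move=> a b; rewrite mulrN cosB cosD; field.
by apply: psd_add; apply: psd_scale; [lra|exact: psd_cos|lra|exact: psd_cos].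
Qed.

Lemma cvg_sum (R : realType) (I : Type) (r : seq I) (f : I -> nat -> R)
    (l : I -> R) :
  (forall i, f i n @[n --> \oo] --> l i) ->
  \sum_(i <- r) f i n @[n --> \oo] --> \sum_(i <- r) l i.
Proof.
by move=> h; apply: cvg_big => [|i _]; [exact: add_continuous|exact: h].
Qed.

Lemma psd_lim (R : realType) (c : nat -> int -> int -> R) (d : int -> int -> R) :
  (forall a b, c n a b @[n --> \oo] --> d a b) -> (forall n, psd (c n)) ->
  psd d.
Proof.
move=> cd hc I p x.
pose S n := \sum_(m : I) \sum_(k : I)
   c n ((p m).1 - (p k).1) ((p m).2 - (p k).2) * (x m * x k).
have SL : S n @[n --> \oo] --> \sum_(m : I) \sum_(k : I)
   d ((p m).1 - (p k).1) ((p m).2 - (p k).2) * (x m * x k).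
  apply: cvg_sum => m; apply: cvg_sum => k.
  by apply: cvgMr_tmp; exact: cd.
rewrite -(cvg_lim (@Rhausdorff R) SL); apply: limr_ge.
  by apply/cvg_ex; eexists; exact: SL.
by near=> n; exact: hc.
Unshelve. all: by end_near. Qed.

(** * Averages over midpoint grids *)

(** For [j < n] these are the midpoints of [n] equal cells of (0, pi); larger [j] continue the grid
    with the same mesh, as [unfold_sum] requires. *)
Definition midpt {R : realType} (n j : nat) : R := (j%:R + 2^-1) * (pi / n%:R).

Lemma midpt_bounds (R : realType) (n j : nat) : (j < n)%N ->
  0 < (midpt n j : R) < pi.
Proof.
move=> jn; have n0 : 0 < n%:R :> R by rewrite ltr0n (leq_ltn_trans _ jn).
have j0 : 0 <= j%:R :> R by [].
have jn' : j%:R + 1 <= n%:R :> R by rewrite natr1 ler_nat.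
have p0 := pi_gt0 R.
rewrite /midpt mulrA ltr_pdivrMr// divr_gt0//=; first by nra.
by apply: mulr_gt0 => //; lra.
Qed.

Lemma sin_nat_pi (R : realType) (k : nat) : sin (k%:R * pi) = 0 :> R.
Proof.
elim: k => [|k IH]; first by rewrite mul0r sin0.
by rewrite -natr1 mulrDl mul1r sinD IH sinpi mulr0 mul0r addr0.
Qed.

(** Telescoping: [2 sin (u / 2) cos ((j + 1/2) u) = sin ((j + 1) u) - sin (j u)]. *)
Lemma dirichlet_sum (R : realType) (n : nat) (u : R) :
  2 * sin (u / 2) * \sum_(j < n) cos ((j%:R + 2^-1) * u) = sin (n%:R * u).
Proof.
elim: n => [|n IH]; first by rewrite big_ord0 mulr0 mul0r sin0.
rewrite big_ord_recr /= mulrDr IH.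
have -> : n%:R * u = (n%:R + 2^-1) * u - u / 2 by field.
have -> : n.+1%:R * u = (n%:R + 2^-1) * u + u / 2 by rewrite -natr1; field.
by rewrite sinB sinD; ring.
Qed.

Lemma sum_cos_midpt (R : realType) (n k : nat) : (0 < k < n.*2)%N ->
  \sum_(j < n) cos (k%:R * midpt n j) = 0 :> R.
Proof.
move=> /andP[k0 kn].
have n0 : 0 < n%:R :> R by rewrite ltr0n; case: n kn.
have k0' : 0 < k%:R :> R by rewrite ltr0n.
have kn' : k%:R < 2 * n%:R :> R by rewrite -natrM ltr_nat mul2n.
have p0 := pi_gt0 R.
have := dirichlet_sum R n (k%:R * (pi / n%:R)).
have -> : n%:R * (k%:R * (pi / n%:R)) = k%:R * pi :> R by field; rewrite gt_eqF.
(* As [0 < k < 2 n], half of [k * (pi / n)] lies in (0, pi), so its sine is nonzero and the cosine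
   sum must vanish. *)
rewrite sin_nat_pi => /eqP; rewrite mulf_eq0 gt_eqF/=; last first.
  rewrite mulr_gt0// sin_gt0_pi// !mulr_gt0 ?invr_gt0//=.
  have -> : k%:R * (pi / n%:R) / 2 = k%:R * pi / (2 * n%:R) :> R.
    by field; rewrite gt_eqF.
  by rewrite ltr_pdivrMr ?mulr_gt0//; nra.
move=> /eqP h; rewrite -[RHS]h; apply: eq_bigr => j _.
by congr cos; rewrite /midpt; ring.
Qed.

Lemma avg_cos_midpt (R : realType) (n k : nat) : (k < n.*2)%N ->
  n%:R^-1 * \sum_(j < n) cos (k%:R * midpt n j) = (k == 0%N)%:R :> R.
Proof.
move=> kn; case: k kn => [|k] kn; last by rewrite sum_cos_midpt// mulr0.
under eq_bigr do rewrite mul0r cos0.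
rewrite sumr_const card_ord mulVf// pnatr_eq0.
by case: n kn.
Qed.

Lemma avg_cos_cvg (R : realType) (a : int) :
  n.+1%:R^-1 * \sum_(j < n.+1) cos (a%:~R * midpt n.+1 j) @[n --> \oo]
  --> ((a == 0)%:R : R).
Proof.
apply: cvg_near_cst; near=> n.
have an : (`|a| < n.+1.*2)%N.
  have h : (`|a| <= n)%N by near: n; exact: nbhs_infty_ge.
  by rewrite (leq_ltn_trans h)// -addnn ltn_addl.
rewrite -absz_eq0 -(avg_cos_midpt R _ _ an); congr (_ * _).
apply: eq_bigr => j _; rewrite natr_absz.
by case: (ger0P a) => _//; rewrite ?intrN ?mulNr ?cosN.
Unshelve. all: by end_near. Qed.

(** Midpoint rule for the mean over (0, pi) of [sin (y phi) * sin phi / (ch t - cos phi)], which is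
    [expR (- (y * t))] for integers [y > 0]. *)
Definition poisson_avg {R : realType} (n : nat) (y t : R) : R :=
  n%:R^-1 * \sum_(l < n) sin (y * midpt n l)
    * (sin (midpt n l) / (ch t - cos (midpt n l))).

Lemma poisson_avg_le (R : realType) (n : nat) (y t : R) : 0 < t ->
  `|poisson_avg n y t| <= t^-1.
Proof.
move=> t0; case: n => [|n].
  by rewrite /poisson_avg invr0 mul0r normr0 invr_ge0 ltW.
rewrite /poisson_avg normrM gtr0_norm ?invr_gt0 ?ltr0n//.
rewrite ler_pdivrMl ?ltr0n//; apply: le_trans (ler_norm_sum _ _ _) _.
have -> : n.+1%:R * t^-1 = \sum_(l < n.+1) t^-1.
  by rewrite sumr_const card_ord mulr_natl.
apply: ler_sum => l _.
have h := midpt_bounds R _ _ (ltn_ord l).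
have d0 : 0 < ch t - cos (midpt n.+1 l) by rewrite ch_sub_gt0 ?cos_le1.
have s0 := sin_gt0_pi h.
rewrite normrM [X in _ * X]gtr0_norm ?divr_gt0//.
apply: (@le_trans _ _ (1 * (sin (midpt n.+1 l) / (ch t - cos (midpt n.+1 l))))).
  apply: ler_wpM2r; first by rewrite divr_ge0 ?ltW.
  by rewrite ler_norml sin_geN1 sin_le1.
rewrite mul1r -(ler_pM2r t0) mulVf ?gt_eqF//.
by have := cosh_ratio_le1 R (midpt n.+1 l) t t0; rewrite /cosh_ratio; lra.
Qed.

(** Since [sin ((k+2) x) + sin (k x) = 2 cos x sin ((k+1) x)], the denominator cancels and the
    average of [cos (k x) - cos ((k+2) x)] remains: 1 for [k = 0], else 0. The value 1 at index 0,
    that of [expR 0], absorbs the exception. *)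
Lemma poisson_avg_rec (R : realType) (n k : nat) (t : R) : 0 < t ->
  (k.+2 < n.*2)%N ->
  poisson_avg n k.+2%:R t = 2 * ch t * poisson_avg n k.+1%:R t
    - (if k is 0 then 1 else poisson_avg n k%:R t).
Proof.
move=> t0 kn.
have key : 2 * ch t * poisson_avg n k.+1%:R t - poisson_avg n k.+2%:R t
    - poisson_avg n k%:R t = (k == 0%N)%:R.
  transitivity (n%:R^-1 * \sum_(l < n) cos (k%:R * midpt n l)
    - n%:R^-1 * \sum_(l < n) cos (k.+2%:R * midpt n l) : R); last first.
    by rewrite !avg_cos_midpt ?subr0// (leq_trans _ kn)// ltnW.
  rewrite /poisson_avg -!mulrBr [2 * ch t * _]mulrCA -!mulrBr; congr (_ * _).
  rewrite mulr_sumr -!sumrB; apply: eq_bigr => l _.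
  have d0 : ch t - cos (midpt n l) != 0.
    by rewrite gt_eqF// ch_sub_gt0 ?cos_le1.
  have -> : k.+2%:R * midpt n l = k.+1%:R * midpt n l + midpt n l :> R.
    by rewrite -[k.+2%:R]natr1; ring.
  have -> : k%:R * midpt n l = k.+1%:R * midpt n l - midpt n l :> R.
    by rewrite -[k.+1%:R]natr1; ring.
  by rewrite !sinD !cosD !sinN !cosN; field.
case: k kn key => [|k] kn; last by move=> /=; lra.
have -> : poisson_avg n 0%:R t = 0.
  by rewrite /poisson_avg big1 ?mulr0// => l _; rewrite mul0r sin0 mul0r.
by move=> /=; lra.
Qed.

Lemma sh_rec (R : realType) (u t : R) :
  sh (u + t) = 2 * ch t * sh u - sh (u - t).
Proof. by rewrite /sh /ch opprB opprD !expRD; field. Qed.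

(* The error satisfies a recurrence whose solutions grow like sh; being bounded
   at index n, it is small at fixed indices. *)
Lemma poisson_avg_err (R : realType) (n k : nat) (t : R) : 0 < t ->
  (k < n)%N ->
  `|(if k is 0 then 1 else poisson_avg n k%:R t) - expR (- (k%:R * t))|
  <= (t^-1 + 1) * sh (k%:R * t) / t * n%:R^-1.
Proof.
move=> t0 kn.
pose y k : R := (if k is 0 then 1 else poisson_avg n k%:R t) - expR (- (k%:R * t)).
have y0 : y 0%N = 0 by rewrite /y mul0r oppr0 expR0 subrr.
have yrec i : (i.+2 < n.*2)%N -> y i.+2 = 2 * ch t * y i.+1 - y i.
  move=> h; rewrite /y /= poisson_avg_rec//.
  have -> : - (i.+2%:R * t) = - (i.+1%:R * t) - t by rewrite -[i.+2%:R]natr1; ring.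
  have -> : - (i%:R * t) = - (i.+1%:R * t) + t by rewrite -[i.+1%:R]natr1; ring.
  by rewrite !expRD /ch; case: i {h} => [|i] /=; field.
have st0 : 0 < sh t by apply: lt_le_trans (sh_ge_id _ _ (ltW t0)).
(* [y i] and [sh (i * t)] obey the same recurrence and vanish at [i = 0], so they are
   proportional. *)
have ysh i : (i.+1 < n.*2)%N ->
    sh t * y i = y 1%N * sh (i%:R * t) /\ sh t * y i.+1 = y 1%N * sh (i.+1%:R * t).
  elim: i => [|i IH] h.
    by rewrite y0 mul0r mul1r /sh oppr0 subrr; split; ring.
  have [h1 h2] := IH (ltnW h); split=> //; rewrite yrec//.
  have -> : i.+2%:R * t = i.+1%:R * t + t by rewrite -[i.+2%:R]natr1; ring.
  rewrite sh_rec; have -> : i.+1%:R * t - t = i%:R * t by rewrite -[i.+1%:R]natr1; ring.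
  transitivity (2 * ch t * (sh t * y i.+1) - sh t * y i); first by ring.
  by rewrite h2 h1; ring.
have n0 : (0 < n)%N by case: n kn {y y0 yrec ysh}.
have nR : 0 < n%:R :> R by rewrite ltr0n.
have ltn2 i : (i < n)%N -> (i.+1 < n.*2)%N by move=> h; lia.
have [yk _] := ysh k (ltn2 _ kn).
have pn : (n.-1 < n)%N by rewrite prednK.
have [_ yn] := ysh n.-1 (ltn2 _ pn).
rewrite prednK// in yn.
(* This crude bound at index [n], divided by [sh (n * t) >= n * t], yields the rate [1 / n] at index
   [k]. *)
have yb : `|y n| <= t^-1 + 1.
  rewrite /y; case: (n) n0 => // m _.
  rewrite (le_trans (ler_normB _ _))// lerD ?poisson_avg_le//.
  by rewrite gtr0_norm ?expR_gt0// -expR0 ler_expR oppr_le0 mulr_ge0// ltW.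
have snt : n%:R * t <= sh (n%:R * t) by apply: sh_ge_id; rewrite mulr_ge0// ltW.
have skt : 0 <= sh (k%:R * t).
  by apply: le_trans (sh_ge_id _ _ _); rewrite mulr_ge0// ltW.
have e : y k = y n * sh (k%:R * t) / sh (n%:R * t).
  have s1 : sh (n%:R * t) != 0 by rewrite gt_eqF// (lt_le_trans _ snt)// mulr_gt0.
  apply: (mulfI (lt0r_neq0 st0)); rewrite yk.
  by rewrite !mulrA yn; field.
rewrite -/(y k) e normrM normrM (ger0_norm skt) -[leLHS]mulrA.
have -> : (t^-1 + 1) * sh (k%:R * t) / t * n%:R^-1
    = (t^-1 + 1) * (sh (k%:R * t) * (t^-1 * n%:R^-1)) by rewrite !mulrA.
apply: ler_pM => //; first exact: mulr_ge0.
apply: ler_wpM2l => //; rewrite normfV ger0_norm; last first.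
  by apply: le_trans snt; rewrite mulr_ge0// ltW.
have nt : 0 < n%:R * t by rewrite mulr_gt0.
by rewrite -invfM [t * _]mulrC lef_pV2 ?posrE// (lt_le_trans nt).
Qed.

Lemma cvg_of_harmonic_bound (R : realType) (f : nat -> R) (C l : R) :
  (\forall n \near \oo, `|f n - l| <= C * n.+1%:R^-1) -> f n @[n --> \oo] --> l.
Proof.
move=> h.
have C0 : C * n.+1%:R^-1 @[n --> \oo] --> 0.
  by rewrite -(mulr0 C); apply: cvgMl_tmp; exact: cvg_harmonic.
have N0 : `|f n - l| @[n --> \oo] --> (0 : R).
  apply: (squeeze_cvgr _ (cvg_cst 0) C0).
  by apply: filterS h => n ->; rewrite normr_ge0.
by apply/subr_cvg0; apply: norm_cvg0; exact: N0.
Qed.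

Definition odd_exp {R : realType} (y t : R) : R :=
  Num.sg y * expR (- (`|y| * t)).

Lemma poisson_avg_cvg (R : realType) (b : int) (t : R) : 0 < t ->
  poisson_avg n.+1 b%:~R t @[n --> \oo] --> odd_exp b%:~R t.
Proof.
move=> t0.
have pos (k : nat) : poisson_avg n.+1 k%:R t @[n --> \oo] --> odd_exp k%:R t.
  case: k => [|k].
    rewrite /odd_exp sgr0 mul0r; apply: cvg_near_cst; near=> n.
    by rewrite /poisson_avg big1 ?mulr0// => l _; rewrite mul0r sin0 mul0r.
  rewrite /odd_exp gtr0_sg// mul1r ger0_norm//.
  apply: (@cvg_of_harmonic_bound _ _ ((t^-1 + 1) * sh (k.+1%:R * t) / t)).
  near=> n; apply: (@poisson_avg_err R n.+1 k.+1 t t0).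
  by rewrite ltnS; near: n; exact: nbhs_infty_gt.
case: b => k; first exact: pos.
rewrite NegzE intrN /odd_exp sgrN normrN mulNr.
rewrite (_ : (fun n => _) = (fun n => - poisson_avg n.+1 k.+1%:R t)).
  by apply: cvgN; exact: pos.
apply/funext => n; rewrite /poisson_avg -mulrN -sumrN; congr (_ * _).
by apply: eq_bigr => l _; rewrite mulNr sinN mulNr.
Unshelve. all: by end_near. Qed.

(** * A geometric sine series *)

(* The closed form of the sum in geometric_sine_cvg, up to the factor alpha / 2. *)
Definition geometric_sine_value {R : realType} (a b alpha : R) : R :=
  let X := 1 - expR (- (b * alpha)) * cos (a * alpha) in
  let Y := expR (- (b * alpha)) * sin (a * alpha) in
  let C := expR (- (b * (alpha / 2))) * cos (a * (alpha / 2)) in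
  let S := expR (- (b * (alpha / 2))) * sin (a * (alpha / 2)) in
  ((S * (2 - X) + C * Y) * (X ^+ 2 - Y ^+ 2)
   + (C * (2 - X) - S * Y) * (2 * X * Y)) / (X ^+ 2 + Y ^+ 2) ^+ 2.

Section geometric_sine_series.
Variables (R : realType) (a b alpha : R).
Hypotheses (b_gt0 : 0 < b) (alpha_gt0 : 0 < alpha).

Let t (i : nat) : R := (i%:R + 2^-1) * alpha.
Let C i : R := expR (- (b * t i)) * cos (a * t i).
Let S i : R := expR (- (b * t i)) * sin (a * t i).
Let X : R := 1 - expR (- (b * alpha)) * cos (a * alpha).
Let Y : R := expR (- (b * alpha)) * sin (a * alpha).

(* With q = exp((-b + i a) alpha / 2), so that C i + i S i = q^(2i+1), this is
   the imaginary part of q^(2J+1) ((2J+1) - (2J-1) q^2) (X + i Y)^2,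
   where X - i Y = 1 - q^2. *)
Let V (J : nat) : R :=
  (S J * (2 + (2 * J%:R - 1) * X) - C J * ((2 * J%:R - 1) * Y)) * (X ^+ 2 - Y ^+ 2)
  + (C J * (2 + (2 * J%:R - 1) * X) + S J * ((2 * J%:R - 1) * Y)) * (2 * X * Y).

Let tS i : t i.+1 = t i + alpha.
Proof. by rewrite /t -natr1; ring. Qed.

Let CS i : C i.+1 = (1 - X) * C i - Y * S i.
Proof.
rewrite /C /S /X /Y tS !mulrDr opprD expRD cosD.
by ring.
Qed.

Let SS i : S i.+1 = (1 - X) * S i + Y * C i.
Proof.
rewrite /C /S /X /Y tS !mulrDr opprD expRD sinD.
by ring.
Qed.

(** As [t i = (2 i + 1) * alpha / 2], this is the imaginary part of a differentiated geometric
    series in q^2, with denominator cleared by [|1 - q^2|^4]; each summand is a difference of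
    consecutive [V]. *)
Lemma geometric_sine_sum J :
  (X ^+ 2 + Y ^+ 2) ^+ 2 * \sum_(i < J) t i * S i = alpha / 2 * (V 0 - V J).
Proof.
elim: J => [|J IH]; first by rewrite big_ord0 mulr0 subrr mulr0.
rewrite big_ord_recr /= mulrDr IH.
suff : (X ^+ 2 + Y ^+ 2) ^+ 2 * (t J * S J) = alpha / 2 * (V J - V J.+1) by lra.
rewrite /V CS SS -[J.+1%:R]natr1 /t.
by move: X Y (C J) (S J) => x y c s; field.
Qed.

Let X_gt0 : 0 < X.
Proof.
have h : expR (- (b * alpha)) < 1 by rewrite expR_lt1 oppr_lt0 mulr_gt0.
by have := cos_le1 (a * alpha); have := expR_gt0 (- (b * alpha)); rewrite /X; nra.
Qed.

Lemma geometric_sine_den_neq0 : (X ^+ 2 + Y ^+ 2) ^+ 2 != 0.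
Proof. by rewrite sqrf_eq0 gt_eqF// ltr_pwDl ?sqr_ge0// exprn_gt0. Qed.

(** The constant is [2 * 4]: [expR (- y) <= 2 / y^2], and [(J + 1)^2 <= 4 (J + 1/2)^2]. *)
Let exp_decay (z w : R) (J : nat) : 0 <= z <= J%:R + 1 -> `|w| <= 1 ->
  `|z * (expR (- (b * t J)) * w)| <= 8 * (b * alpha) ^- 2 * J.+1%:R^-1.
Proof.
move=> /andP[z0 zJ] w1.
have J0 : 0 <= J%:R :> R by [].
set y := b * t J; set c := b * alpha.
have c0 : 0 < c by rewrite mulr_gt0.
have yE : y = c * (J%:R + 2^-1) by rewrite /y /c /t; ring.
have y0 : 0 < y by rewrite yE; apply: mulr_gt0 => //; lra.
have e1 : expR (- y) <= 2 / y ^+ 2.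
  rewrite expRN -[leRHS]invrK lef_pV2 ?posrE ?expR_gt0 ?invr_gt0 ?divr_gt0 ?exprn_gt0//.
  have := expR_ge1Dxn 1 (ltW y0); rewrite invf_div /= (_ : 2`! = 2%N)//; lra.
rewrite !normrM (ger0_norm z0) (ger0_norm (ltW (expR_gt0 _))).
apply: (@le_trans _ _ ((J%:R + 1) * (2 / y ^+ 2 * 1))).
  by rewrite !ler_pM ?mulr_ge0 ?normr_ge0 ?(ltW (expR_gt0 _)).
rewrite -[J.+1%:R]natr1 mulr1 yE exprMn.
rewrite ler_pdivlMr; last lra.
rewrite (_ : _ * _ * _ = 2 * c ^- 2 * ((J%:R + 1) ^+ 2 / (J%:R + 2^-1) ^+ 2)); last first.
  by field; rewrite gt_eqF//= gt_eqF//; lra.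
rewrite (_ : 8 * _ = 2 * c ^- 2 * 4); last by ring.
apply: ler_wpM2l; first by rewrite mulr_ge0// invr_ge0 exprn_ge0// ltW.
by rewrite ler_pdivrMr ?exprn_gt0//; nra.
Qed.

Let decay_cvg (z : nat -> R) (w : nat -> R) :
  (forall J, 0 <= z J <= J%:R + 1) -> (forall J, `|w J| <= 1) ->
  z J * (expR (- (b * t J)) * w J) @[J --> \oo] --> 0.
Proof.
move=> hz hw; apply: (@cvg_of_harmonic_bound _ _ (8 * (b * alpha) ^- 2)).
by apply: nearW => J; rewrite subr0; exact: exp_decay.
Qed.

Lemma geometric_sine_cvg :
  \sum_(i < J) t i * S i @[J --> \oo] -->
  alpha / 2 * geometric_sine_value a b alpha.
Proof.
have -> : geometric_sine_value a b alpha = V 0 / (X ^+ 2 + Y ^+ 2) ^+ 2.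
  rewrite /geometric_sine_value /V /C /S /t /X /Y add0r [2^-1 * alpha]mulrC.
  by congr (_ / _); ring.
rewrite mulrA.
have den := geometric_sine_den_neq0.
have cos1 (J : nat) : `|cos (a * t J)| <= 1 by rewrite ler_norml cos_geN1 cos_le1.
have sin1 (J : nat) : `|sin (a * t J)| <= 1 by rewrite ler_norml sin_geN1 sin_le1.
have z1 (J : nat) : 0 <= (1 : R) <= J%:R + 1 by rewrite ler01 lerDr ler0n.
have zJ (J : nat) : 0 <= (J%:R : R) <= J%:R + 1 by rewrite ler0n lerDl ler01.
have VL : V J @[J --> \oo] --> 0.
  pose D := X ^+ 2 - Y ^+ 2; pose M := 2 * X * Y.
  have -> : V = (fun J => (1 * S J) * ((2 - X) * D - Y * M)
      + (J%:R * S J) * (2 * X * D + 2 * Y * M)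
      + ((1 * C J) * (Y * D + (2 - X) * M)
      + (J%:R * C J) * (- 2 * Y * D + 2 * X * M))).
    by apply/funext => J; rewrite /V -/D -/M; ring.
  rewrite -[X in _ --> X](_ : 0 * ((2 - X) * D - Y * M)
      + 0 * (2 * X * D + 2 * Y * M) + (0 * (Y * D + (2 - X) * M)
      + 0 * (- 2 * Y * D + 2 * X * M)) = 0); last by ring.
  by apply: cvgD; apply: cvgD; apply: cvgMr_tmp; apply: decay_cvg.
have -> : (fun J => \sum_(i < J) t i * S i)
    = (fun J => alpha / 2 * (V 0 - V J) / (X ^+ 2 + Y ^+ 2) ^+ 2).
  by apply/funext => J; rewrite -geometric_sine_sum [RHS]mulrC mulKf.
rewrite -[V 0 in X in _ --> X]subr0.
apply: cvgMr_tmp; apply: cvgMl_tmp; apply: cvgB => //; exact: cvg_cst.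
Qed.

End geometric_sine_series.

(** * Limits at 0 from the right *)

Lemma is_derive_at_right (R : realType) (f : R -> R) (d : R) :
  is_derive (0 : R) (1 : R) f d -> f 0 = 0 -> f x / x @[x --> 0^'+] --> d.
Proof.
move=> fd f0.
have : h^-1 *: ((f \o shift 0) (h *: (1 : R)) - f 0) @[h --> 0^'] --> d.
  by have [/cvg_lim h <-] := fd; have [] := fd.
move=> /cvg_dnbhs_at_right; apply: cvg_trans; apply: near_eq_cvg.
near=> x; rewrite /= addr0 f0 subr0 /GRing.scale /= mulr1 mulrC.
by [].
Unshelve. all: by end_near. Qed.

Lemma derivable_cvg_at_right (R : realType) (f : R -> R) :
  derivable f 0 1 -> f x @[x --> 0^'+] --> f 0.
Proof.
move=> /derivable1_diffP /differentiable_continuous h.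
exact: cvg_at_right_filter.
Qed.

(* The Riemann sums over midpoints of \int_0^oo t exp(-b t) sin(a t) dt, which
   is the imaginary part of 1 / (b - i a)^2. *)
Lemma geometric_sine_scaling (R : realType) (a b : R) : 0 < b ->
  x ^+ 2 * geometric_sine_value a b x @[x --> 0^'+]
  --> 4 * (a * b) / (a ^+ 2 + b ^+ 2) ^+ 2.
Proof.
move=> b0.
pose X x : R := 1 - expR (- (b * x)) * cos (a * x).
pose Y x : R := expR (- (b * x)) * sin (a * x).
pose c x : R := expR (- (b * (x / 2))) * cos (a * (x / 2)).
pose s x : R := expR (- (b * (x / 2))) * sin (a * (x / 2)).
have X0 : X x / x @[x --> 0^'+] --> b.
  apply: is_derive_at_right; last by rewrite /X !mulr0 oppr0 expR0 cos0 mul1r subrr.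
  apply: is_derive_eq; rewrite /GRing.scale /= !mulr0 oppr0 expR0 cos0 sin0; ring.
have Y0 : Y x / x @[x --> 0^'+] --> a.
  apply: is_derive_at_right; last by rewrite /Y !mulr0 sin0 mulr0.
  apply: is_derive_eq; rewrite /GRing.scale /= !mulr0 oppr0 expR0 cos0 sin0; ring.
have id0 : (x : R) @[x --> 0^'+] --> (0 : R) by exact: cvg_at_right_filter.
have S0 : s x @[x --> 0^'+] --> (0 : R).
  have e : s 0 = 0 by rewrite /s mul0r !mulr0 sin0 mulr0.
  by rewrite -[X in _ --> X]e; apply: derivable_cvg_at_right; rewrite /s.
have C0 : c x @[x --> 0^'+] --> (1 : R).
  have e : c 0 = 1 by rewrite /c mul0r !mulr0 oppr0 expR0 cos0 mulr1.
  by rewrite -[X in _ --> X]e; apply: derivable_cvg_at_right; rewrite /c.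
(* The value [x^2 * geometric_sine_value] in terms of [u = X x / x] and [y = Y x / x]: the powers of
   [x] cancel and the denominator tends to [(b^2 + a^2)^2], which is nonzero. *)
pose U (x y u v w : R) := ((v * (2 - u * x) + w * (y * x)) * (u ^+ 2 - y ^+ 2)
   + (w * (2 - u * x) - v * (y * x)) * (2 * u * y)) / (u ^+ 2 + y ^+ 2) ^+ 2.
have UL : U x (Y x / x) (X x / x) (s x) (c x) @[x --> 0^'+] --> U 0 a b 0 1.
  have two : (2 : R) @[_ --> (0 : R)^'+] --> (2 : R) by exact: cvg_cst.
  have cM := @cvgM R R (0^'+) (at_right_proper_filter (0 : R)).
  have cD := @cvgD R R R (0^'+) (at_right_proper_filter (0 : R)).
  have cB := @cvgB R R R (0^'+) (at_right_proper_filter (0 : R)).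
  have X2 := cM _ _ _ _ X0 X0; have Y2 := cM _ _ _ _ Y0 Y0.
  have Xx := cB _ _ _ _ two (cM _ _ _ _ X0 id0); have Yx := cM _ _ _ _ Y0 id0.
  have D2 := cM _ _ _ _ (cD _ _ _ _ X2 Y2) (cD _ _ _ _ X2 Y2).
  have N1 := cM _ _ _ _
    (cD _ _ _ _ (cM _ _ _ _ S0 Xx) (cM _ _ _ _ C0 Yx)) (cB _ _ _ _ X2 Y2).
  have N2 := cM _ _ _ _
    (cB _ _ _ _ (cM _ _ _ _ C0 Xx) (cM _ _ _ _ S0 Yx))
    (cM _ _ _ _ (cM _ _ _ _ two X0) Y0).
  have D0 : (b * b + a * a) * (b * b + a * a) != 0.
    by rewrite -!expr2 sqrf_eq0 gt_eqF// ltr_pwDl ?sqr_ge0// exprn_gt0.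
  have D1 := @cvgV R R (0^'+) (at_right_proper_filter (0 : R)) _ _ D0 D2.
  exact: cM _ _ _ _ (cD _ _ _ _ N1 N2) D1.
have <- : U 0 a b 0 1 = 4 * (a * b) / (a ^+ 2 + b ^+ 2) ^+ 2.
  by rewrite /U [a ^+ 2 + _]addrC; congr (_ / _); ring.
apply: cvg_trans UL; apply: near_eq_cvg; near=> x.
have x0 : 0 < x by near: x; exact: nbhs_right_gt.
rewrite /U /geometric_sine_value -/(X x) -/(Y x) -/(c x) -/(s x).
move: (X x) (Y x) (c x) (s x) => X' Y' c' s'.
(* If the denominator vanishes, both sides are 0, the inverse of 0 being 0. *)
have [h|h] := eqVneq (X' ^+ 2 + Y' ^+ 2) 0.
  by rewrite !expr_div_n -mulrDl h mul0r expr0n /= invr0 !mulr0.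
by field; rewrite h gt_eqF.
Unshelve. all: by end_near. Qed.

(** * The quadratic form of the kernel *)

Lemma sin_period (R : realType) (m : int) (x : R) :
  sin (m%:~R * (2 * pi) + x) = sin x.
Proof.
have pos (k : nat) (y : R) : sin (y + k%:R * (2 * pi)) = sin y.
  rewrite -(periodicn (@sinD2pi R) k y); congr sin.
  by rewrite -[in RHS]mulr_natr -mulr_natl; ring.
case: m => k; first by rewrite addrC pos.
by rewrite NegzE intrN -(pos k.+1); congr sin; rewrite mulNr addrAC addNr add0r.
Qed.

(** The intervals reached by [theta], [2 k pi - theta] and [2 k pi + theta], [1 <= k <= K], tile (0,
    (2K + 1) pi), and these maps send midpoints to midpoints; the reflected ones are traversed
    backwards. *)
Lemma unfold_sum (R : realType) (h : R -> R) (L K : nat) : (0 < L)%N ->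
  \sum_(j < L) (h (midpt L j) + \sum_(k < K)
    (h (k.+1%:R * (2 * pi) + midpt L j) + h (k.+1%:R * (2 * pi) - midpt L j)))
  = \sum_(i < K.*2.+1 * L) h (midpt L i).
Proof.
move=> L0; have LR : L%:R != 0 :> R by rewrite pnatr_eq0 -lt0n.
elim: K => [|K IH].
  by rewrite mul1n; apply: eq_bigr => j _; rewrite big_ord0 addr0.
under eq_bigr do rewrite big_ord_recr /= addrA.
rewrite big_split /= IH.
have -> : (K.+1.*2.+1 * L = K.*2.+1 * L + (L + L))%N by lia.
rewrite [in RHS]big_split_ord; congr (_ + _).
rewrite [in RHS]big_split_ord big_split /= addrC; congr (_ + _).
  rewrite (reindex_inj rev_ord_inj) /=; apply: eq_bigr => j _; congr h.
  rewrite /midpt natrB ?ltn_ord// natrD natrM -!natr1 -mul2n natrM.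
  by field.
apply: eq_bigr => j _; congr h.
by rewrite /midpt !natrD natrM -!natr1 -mul2n natrM; field.
Qed.

(** The minus sign is that of [sin (a * (2 k pi - theta)) = - sin (a * theta)] for integer [a]. *)
Definition folded_kernel {R : realType} (K : nat) (theta y : R) : R :=
  theta * odd_exp y theta + \sum_(k < K)
    ((k.+1%:R * (2 * pi) + theta) * odd_exp y (k.+1%:R * (2 * pi) + theta)
   - (k.+1%:R * (2 * pi) - theta) * odd_exp y (k.+1%:R * (2 * pi) - theta)).

(** An average of [psd_cos_sin] over midpoints phi with weight [eps * s phi], admissible by
    [alternating_sum_bound]. As the grid is refined, the averages of [cos (b phi)] tend to [b == 0]
    and those of [s phi * sin (b phi)] to the folded kernel. *)
Lemma psd_folded (R : realType) (eps theta : R) (K : nat) :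
  `|eps| <= 1 -> 0 < theta < pi ->
  psd (fun a b : int => cos (a%:~R * theta) * (b == 0)%:R
    + eps * (sin (a%:~R * theta) * folded_kernel K theta b%:~R)).
Proof.
move=> eps1 hth; have /andP[th0 thpi] := hth.
pose s phi : R := sin phi * (cosh_ratio (cos phi) theta + \sum_(k < K)
      (cosh_ratio (cos phi) (k.+1%:R * (2 * pi) + theta)
       - cosh_ratio (cos phi) (k.+1%:R * (2 * pi) - theta))).
apply: (@psd_lim _ (fun n a b => n.+1%:R^-1 * \sum_(l < n.+1)
   (cos (a%:~R * theta) * cos (b%:~R * midpt n.+1 l)
    + eps * s (midpt n.+1 l) * (sin (a%:~R * theta) * sin (b%:~R * midpt n.+1 l))))).
  move=> a b.
  pose P n t : R := t * poisson_avg n.+1 b%:~R t.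
  have -> : (fun n => n.+1%:R^-1 * \sum_(l < n.+1)
      (cos (a%:~R * theta) * cos (b%:~R * midpt n.+1 l)
      + eps * s (midpt n.+1 l) * (sin (a%:~R * theta) * sin (b%:~R * midpt n.+1 l))))
    = (fun n => cos (a%:~R * theta) *
         (n.+1%:R^-1 * \sum_(l < n.+1) cos (b%:~R * midpt n.+1 l))
       + eps * (sin (a%:~R * theta) * (P n theta + \sum_(k < K)
       (P n (k.+1%:R * (2 * pi) + theta) - P n (k.+1%:R * (2 * pi) - theta))))).
    apply/funext => n; rewrite big_split /= mulrDr; congr (_ + _).
      by rewrite -mulr_sumr mulrCA.
    have PE t : P n t = n.+1%:R^-1 * \sum_(l < n.+1)
        sin (b%:~R * midpt n.+1 l)
        * (sin (midpt n.+1 l) * cosh_ratio (cos (midpt n.+1 l)) t).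
      rewrite /P /poisson_avg mulrCA; congr (_ * _); rewrite mulr_sumr.
      by apply: eq_bigr => l _; rewrite /cosh_ratio; ring.
    rewrite !PE; under [in RHS]eq_bigr do rewrite !PE -mulrBr -sumrB.
    rewrite -mulr_sumr -mulrDr exchange_big /= -big_split /=.
    rewrite [sin (a%:~R * theta) * (n.+1%:R^-1 * _)]mulrCA.
    rewrite [eps * (_ * _)]mulrCA; congr (_ * _).
    rewrite !mulr_sumr; apply: eq_bigr => l _; rewrite /s.
    under [in RHS]eq_bigr do rewrite -!mulrBr.
    by rewrite -!mulr_sumr; ring.
  have PL t : 0 < t -> P n t @[n --> \oo] --> t * odd_exp b%:~R t.
    by move=> t0; apply: cvgMl_tmp; exact: poisson_avg_cvg.
  apply: cvgD; first by apply: cvgMl_tmp; exact: avg_cos_cvg.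
  apply: cvgMl_tmp; apply: cvgMl_tmp; apply: cvgD; first exact: PL.
  apply: cvg_sum => k.
  have k0 : 0 <= k%:R :> R by [].
  by apply: cvgB; apply: PL; rewrite -[k.+1%:R]natr1; nra.
move=> n; apply: psd_scale; first by rewrite invr_ge0.
apply: psd_sum => l; apply: psd_cos_sin; rewrite normrM mulr_ile1//.
exact: alternating_sum_bound (midpt_bounds R _ _ (ltn_ord l)) hth.
Qed.

(** Averaging [psd_folded] over [L] midpoints [theta]; [unfold_sum] merges the folds into one
    sum. *)
Lemma psd_unfolded (R : realType) (eps : R) (L K : nat) :
  `|eps| <= 1 -> (0 < L)%N ->
  psd (fun a b : int =>
    (L%:R^-1 * \sum_(j < L) cos (a%:~R * midpt L j)) * (b == 0)%:R
    + eps * (L%:R^-1 * \sum_(i < K.*2.+1 * L)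
       midpt L i * sin (a%:~R * midpt L i) * odd_exp b%:~R (midpt L i))).
Proof.
move=> eps1 L0.
apply: (@psd_ext _ (fun a b => L%:R^-1 * \sum_(j < L)
   (cos (a%:~R * midpt L j) * (b == 0)%:R
    + eps * (sin (a%:~R * midpt L j) * folded_kernel K (midpt L j) b%:~R)))).
  move=> a b; rewrite big_split /= mulrDr -mulr_suml mulrA; congr (_ + _).
  rewrite -mulr_sumr mulrCA; congr (_ * (_ * _)).
  rewrite -(@unfold_sum _ (fun t => t * sin (a%:~R * t) * odd_exp b%:~R t))//.
  apply: eq_bigr => j _; rewrite /folded_kernel mulrDr; congr (_ + _); first by ring.
  rewrite mulr_sumr; apply: eq_bigr => k _.
  have e (x : R) : sin (a%:~R * (k.+1%:R * (2 * pi) + x)) = sin (a%:~R * x).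
    rewrite -[RHS](sin_period _ (a * k.+1%:Z)) intrM -[k.+1%:~R]/(k.+1%:R).
    by congr sin; ring.
  by rewrite !e mulrN sinN; ring.
apply: psd_scale; first by rewrite invr_ge0.
by apply: psd_sum => j; apply: psd_folded => //; exact: midpt_bounds.
Qed.

(** The limit of large [K] at fixed mesh [pi / L], summed by [geometric_sine_cvg]. *)
Lemma psd_halfplane (R : realType) (eps : R) (L : nat) :
  `|eps| <= 1 -> (0 < L)%N ->
  psd (fun a b : int =>
    (L%:R^-1 * \sum_(j < L) cos (a%:~R * midpt L j)) * (b == 0)%:R
    + eps * (Num.sg b%:~R / (2 * pi) * ((pi / L%:R) ^+ 2
       * geometric_sine_value a%:~R `|b%:~R| (pi / L%:R)))).
Proof.
move=> eps1 L0; have LR : 0 < L%:R :> R by rewrite ltr0n.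
have p0 := pi_gt0 R.
apply: psd_lim (fun K => @psd_unfolded R eps L K eps1 L0) => a b.
apply: cvgD; first exact: cvg_cst.
apply: cvgMl_tmp.
have [->|b0] := eqVneq b 0.
  rewrite sgr0 !mul0r; apply: cvg_near_cst; apply: nearW => K.
  by rewrite big1 ?mulr0// => i _; rewrite /odd_exp sgr0 mul0r mulr0.
have b1 : 0 < `|b%:~R| :> R by rewrite normr_gt0 intr_eq0.
have a0 : 0 < pi / L%:R :> R by rewrite divr_gt0.
have := @geometric_sine_cvg R a%:~R `|b%:~R| (pi / L%:R) b1 a0.
set v := geometric_sine_value _ _ _ => h.
have -> : Num.sg b%:~R / (2 * pi) * ((pi / L%:R) ^+ 2 * v)
   = L%:R^-1 * (Num.sg b%:~R * (pi / L%:R / 2 * v)).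
  by move: (v) (pi : R) p0 => w c c0; field; rewrite !gt_eqF.
apply: cvgMl_tmp.
under eq_fun do under eq_bigr do rewrite /odd_exp mulrCA.
under eq_fun do rewrite -mulr_sumr.
apply: cvgMl_tmp.
(* Only the partial sums of length [(2 K + 1) L] occur, a subsequence. *)
have sub : (K.*2.+1 * L)%N @[K --> \oo] --> \oo.
  apply/cvgnyPge => A; near=> K.
  have : (A <= K)%N by near: K; exact: nbhs_infty_ge.
  by nia.
apply: cvg_trans (cvg_comp _ _ sub h); apply: near_eq_cvg; apply: nearW => K /=.
by apply: eq_bigr => i _; rewrite -/(midpt L i); ring.
Unshelve. all: by end_near. Qed.

(** The limit of vanishing mesh, by [geometric_sine_scaling]: [4 / (2 pi) = 2 / pi], and the sign of
    [b] turns [a |b|] into [a b]. *)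
Lemma psd_delta_kernel (R : realType) (eps : R) : `|eps| <= 1 ->
  psd (fun a b : int => (a == 0)%:R * (b == 0)%:R
    + eps * (2 / pi * (a%:~R * b%:~R / (a%:~R ^+ 2 + b%:~R ^+ 2) ^+ 2))).
Proof.
move=> eps1.
apply: psd_lim (fun n => @psd_halfplane R eps n.+1 eps1 (ltn0Sn n)) => a b.
apply: cvgD; first by apply: cvgMr_tmp; exact: avg_cos_cvg.
apply: cvgMl_tmp.
have p0 := pi_gt0 R.
have [->|b0] := eqVneq b 0.
  rewrite sgr0 mulr0 !mul0r mulr0; apply: cvg_near_cst; apply: nearW => n.
  by rewrite !mul0r.
have b1 : 0 < `|b%:~R| :> R by rewrite normr_gt0 intr_eq0.
have -> : 2 / pi * (a%:~R * b%:~R / (a%:~R ^+ 2 + b%:~R ^+ 2) ^+ 2) =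
   Num.sg b%:~R / (2 * pi) *
     (4 * (a%:~R * `|b%:~R|) / (a%:~R ^+ 2 + `|b%:~R| ^+ 2) ^+ 2) :> R.
  rewrite [in LHS](numEsg b%:~R) exprMn sqr_sg intr_eq0 b0 mul1r.
  have d0 : 0 < a%:~R ^+ 2 + `|b%:~R| ^+ 2 :> R.
    by rewrite ltr_wpDl ?sqr_ge0// exprn_gt0.
  by move: (pi : R) p0 => c c0; field; rewrite (gt_eqF c0) (gt_eqF d0).
apply: cvgMl_tmp.
apply: (proj1 (cvg_at_rightP _ _ _) (geometric_sine_scaling R a%:~R _ b1)).
split=> [n|]; first by rewrite divr_gt0.
by rewrite -(mulr0 pi); apply: cvgMl_tmp; exact: cvg_harmonic.
Qed.

(** [psd_delta_kernel] at [eps = 1] and [eps = -1] bounds the form on both sides; [p] being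
    injective, the delta contributes only the diagonal. *)
Lemma lattice_form_bound (R : realType) (I : finType) (p : I -> int * int)
    (x : I -> R) : injective p ->
  `|\sum_m \sum_n ((p m).1 - (p n).1)%:~R * ((p m).2 - (p n).2)%:~R
      / (((p m).1 - (p n).1)%:~R ^+ 2 + ((p m).2 - (p n).2)%:~R ^+ 2) ^+ 2
      * (x m * x n)|
  <= pi / 2 * \sum_m x m ^+ 2.
Proof.
move=> pI; set Q := \sum_m _.
have key (eps : R) : `|eps| <= 1 ->
    0 <= (\sum_m x m ^+ 2) + eps * (2 / pi) * Q.
  move=> /psd_delta_kernel /(_ I p x); congr (0 <= _).
  rewrite /Q mulr_sumr -big_split /=; apply: eq_bigr => m _.
  rewrite mulr_sumr; under eq_bigr do rewrite mulrDl.
  rewrite big_split /=; congr (_ + _); last first.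
    by apply: eq_bigr => n _; rewrite -!mulrA.
  rewrite (bigD1 m)//= !subrr !eqxx !mul1r -expr2 big1 ?addr0// => n nm.
  rewrite -natrM mulnb !subr_eq0 -xpair_eqE -!surjective_pairing.
  by rewrite (inj_eq pI) eq_sym (negbTE nm) mul0r.
have p0 := pi_gt0 R.
have h1 := key 1 ltac:(by rewrite normr1).
have h2 := key (-1) ltac:(by rewrite normrN1).
have e : Q = pi / 2 * (2 / pi * Q).
  by move: (pi : R) (Q) p0 => c w c0; field; rewrite gt_eqF.
rewrite e normrM gtr0_norm ?divr_gt0//.
apply: ler_wpM2l; first by rewrite divr_ge0// ltW.
by rewrite ler_norml; apply/andP; split; lra.
Qed.

(** * The resolvent estimate *)

(** Write lambda = [l1 + i l2], u = [x + i y], T u = [p + i q]. The hypotheses make <T u, u> real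
    and equal to [s] |u|^2, so the cross terms vanish and the two sides differ by |T u - s u|^2. *)
Lemma quadratic_shift_bound (R : realType) (k : nat) (l1 l2 s : R)
    (x y p q : 'I_k -> R) :
  \sum_i (p i * x i + q i * y i) = s * \sum_i (x i ^+ 2 + y i ^+ 2) ->
  \sum_i p i * y i = \sum_i q i * x i ->
  ((l1 - s) ^+ 2 + l2 ^+ 2) * \sum_i (x i ^+ 2 + y i ^+ 2) <=
  \sum_i ((l1 * x i - l2 * y i - p i) ^+ 2 + (l1 * y i + l2 * x i - q i) ^+ 2).
Proof.
move=> h1 h2; rewrite -subr_ge0.
have -> : \sum_i ((l1 * x i - l2 * y i - p i) ^+ 2
      + (l1 * y i + l2 * x i - q i) ^+ 2)
    - ((l1 - s) ^+ 2 + l2 ^+ 2) * \sum_i (x i ^+ 2 + y i ^+ 2) =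
    \sum_i ((p i - s * x i) ^+ 2 + (q i - s * y i) ^+ 2)
    + 2 * (s - l1) * (\sum_i (p i * x i + q i * y i)
                      - s * \sum_i (x i ^+ 2 + y i ^+ 2))
    + 2 * l2 * (\sum_i p i * y i - \sum_i q i * x i).
  rewrite -sumrB [_ * \sum_i (_ + _)]mulr_sumr [s * _]mulr_sumr -!sumrB.
  rewrite !mulr_sumr -!big_split /=; apply: eq_bigr => i _; ring.
rewrite h1 h2 !subrr !mulr0 !addr0.
by apply: sumr_ge0 => i _; rewrite addr_ge0 ?sqr_ge0.
Qed.

(** * Distance to the segment *)

Section distance_to_segment.
Variables (R : realType) (lambda : R[i]).

Let dists : set R := [set cabs (lambda - w) | w in segC R].

Let dists_inf : has_inf dists.
Proof.
split; last first.
  by exists 0 => _ [w _ <-]; rewrite /cabs; case: (_ - _) => ? ?; exact: sqrtr_ge0.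
exists (cabs (lambda - 0)); exists 0 => //; exists 0 => //=.
by rewrite oppr_le0 invr_ge0 ler0n.
Qed.

Lemma cabs_sub_real (s : R) :
  cabs (lambda - s%:C%C)
  = Num.sqrt ((complex.Re lambda - s) ^+ 2 + complex.Im lambda ^+ 2).
Proof. by rewrite /cabs; case: lambda => a b /=; rewrite oppr0 addr0. Qed.

Lemma cdist_segC_le (s : R) : - 2^-1 <= s <= 2^-1 ->
  cdist lambda (segC R)
  <= Num.sqrt ((complex.Re lambda - s) ^+ 2 + complex.Im lambda ^+ 2).
Proof.
move=> hs; rewrite -cabs_sub_real; apply: ge_inf; first by case: dists_inf.
by exists s%:C%C => //; exists s.
Qed.

(** Positivity of the infimum needs a uniform lower bound: [|l2|] off the real axis, [|l1| - 1/2] on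
    it. *)
Lemma cdist_segC_gt0 : ~ segC R lambda -> 0 < cdist lambda (segC R).
Proof.
move=> hl; set l1 := complex.Re lambda; set l2 := complex.Im lambda.
have lb (e : R) : 0 < e ->
    (forall s : R, - 2^-1 <= s <= 2^-1 -> e ^+ 2 <= (l1 - s) ^+ 2 + l2 ^+ 2) ->
    0 < cdist lambda (segC R).
  move=> e0 h; apply: (lt_le_trans e0); apply: lb_le_inf; first by case: dists_inf.
  move=> _ [_ [s hs <-] <-]; rewrite cabs_sub_real.
  by rewrite -(ger0_norm (ltW e0)) -sqrtr_sqr ler_wsqrtr// h.
have [l20|l20] := eqVneq l2 0; last first.
  apply: (lb `|l2|); first by rewrite normr_gt0.
  by move=> s _; rewrite real_normK ?num_real// lerDr sqr_ge0.
have hl1 : ~~ (- 2^-1 <= l1 <= 2^-1).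
  apply/negP => h; apply: hl; exists l1 => //.
  by move: l20; rewrite /l1 /l2; case: (lambda) => a b /= ->.
have hl1' : 0 < `|l1| - 2^-1 by rewrite subr_gt0 ltNge ler_norml.
apply: (lb _ hl1') => s hs; rewrite l20 expr0n addr0.
rewrite -[leRHS]real_normK ?num_real// lerXn2r ?nnegrE ?normr_ge0 ?(ltW hl1')//.
have s1 : `|s| <= 2^-1 by rewrite ler_norml.
by have := lerB_dist l1 s; lra.
Qed.

End distance_to_segment.

Lemma cabs_sqr (R : realType) (z : R[i]) :
  cabs z ^+ 2 = complex.Re z ^+ 2 + complex.Im z ^+ 2.
Proof. by case: z => x y; rewrite /cabs /= sqr_sqrtr// addr_ge0 ?sqr_ge0. Qed.

Lemma Re_sum (R : realType) (I : finType) (F : I -> R[i]) :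
  complex.Re (\sum_i F i) = \sum_i complex.Re (F i).
Proof. exact: (raddf_sum (@complex.Re R)). Qed.

Lemma Im_sum (R : realType) (I : finType) (F : I -> R[i]) :
  complex.Im (\sum_i F i) = \sum_i complex.Im (F i).
Proof. exact: (raddf_sum (@complex.Im R)). Qed.

Lemma l2norm_eq0 (R : realType) (k : nat) (v : 'cV[R[i]]_k) :
  l2norm v = 0 -> v = 0.
Proof.
move=> /eqP; rewrite sqrtr_eq0 => v0; apply/matrixP => i j; rewrite ord1 mxE.
apply: ComplexField.Normc.eq0_normc; apply/eqP; rewrite -sqrf_eq0.
have /psumr_eq0P h : forall i, true -> 0 <= cabs (v i 0) ^+ 2.
  by move=> *; exact: sqr_ge0.
rewrite [X in X == 0]h//; apply/eqP; rewrite eq_le v0 sumr_ge0// => *.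
exact: sqr_ge0.
Qed.

(** By symmetry the form at [x + i y] is the sum of the real forms at [x] and [y]. Hence the
    Rayleigh quotient [s] lies in the segment, and [cdist] is at most |lambda - s|. *)
Lemma resolvent_lower_bound (R : realType) (k : nat) (lambda : R[i])
    (T : 'M[R]_k) (v : 'cV[R[i]]_k) :
  (forall i j, T i j = T j i) ->
  (forall x : 'I_k -> R, `|\sum_i \sum_j T i j * (x i * x j)|
                         <= 2^-1 * \sum_i x i ^+ 2) ->
  cdist lambda (segC R) * l2norm v
  <= l2norm ((lambda%:M - map_mx (real_complex R) T) *m v).
Proof.
move=> Tsym Tbound.
pose x i := complex.Re (v i 0); pose y i := complex.Im (v i 0).
pose p i := \sum_j T i j * x j; pose q i := \sum_j T i j * y j.
pose r := \sum_i (x i ^+ 2 + y i ^+ 2).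
have r0 : 0 <= r by apply: sumr_ge0 => i _; rewrite addr_ge0 ?sqr_ge0.
have vr : l2norm v = Num.sqrt r.
  by congr Num.sqrt; apply: eq_bigr => i _; rewrite cabs_sqr.
have [rE|rn0] := eqVneq r 0.
  by rewrite vr rE sqrtr0 mulr0 sqrtr_ge0.
have rgt0 : 0 < r by rewrite lt_def rn0.
have form (z w : 'I_k -> R) :
    \sum_i (\sum_j T i j * z j) * w i = \sum_i \sum_j T i j * (w i * z j).
  by apply: eq_bigr => i _; rewrite mulr_suml; apply: eq_bigr => j _; ring.
pose m := \sum_i (p i * x i + q i * y i).
have mE : m = \sum_i \sum_j T i j * (x i * x j) + \sum_i \sum_j T i j * (y i * y j).
  by rewrite /m big_split /= !form.
have mr : `|m| <= 2^-1 * r.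
  rewrite mE /r big_split mulrDr.
  exact: le_trans (ler_normD _ _) (lerD (Tbound x) (Tbound y)).
pose s := m / r.
have hs : - 2^-1 <= s <= 2^-1.
  by rewrite -ler_norml normrM normfV (gtr0_norm rgt0) ler_pdivrMr.
have pqE : \sum_i p i * y i = \sum_i q i * x i.
  rewrite !form exchange_big; apply: eq_bigr => i _; apply: eq_bigr => j _.
  by rewrite Tsym; ring.
have msr : m = s * r by rewrite /s divfK.
have := @quadratic_shift_bound R k (complex.Re lambda) (complex.Im lambda) s
  x y p q msr pqE.
rewrite -/r => H.
have dE := cdist_segC_le R lambda s hs.
have d0 : 0 <= (complex.Re lambda - s) ^+ 2 + complex.Im lambda ^+ 2.
  by rewrite addr_ge0 ?sqr_ge0.
rewrite vr; apply: (le_trans (ler_wpM2r (sqrtr_ge0 _) dE)).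
rewrite -sqrtrM// ler_wsqrtr//; apply: (le_trans H).
rewrite le_eqVlt; apply/orP; left; apply/eqP; apply: eq_bigr => i _.
rewrite cabs_sqr mulmxBl mul_scalar_mx !mxE.
have -> : \sum_j (map_mx (real_complex R) T) i j * v j 0
    = Complex (p i) (q i).
  have vE j : v j 0 = Complex (x j) (y j) by rewrite /x /y; case: (v j 0).
  apply/eqP; rewrite eq_complex Re_sum Im_sum; apply/andP; split; apply/eqP;
    by apply: eq_bigr => j _; rewrite mxE vE /= mul0r ?subr0 ?addr0.
have -> : v i 0 = Complex (x i) (y i) by rewrite /x /y; case: (v i 0).
by case: (lambda) => l1 l2 /=; congr (_ ^+ 2 + _ ^+ 2).
Qed.

Lemma unitmx_of_lower_bound (R : realType) (k : nat) (d : R) (A : 'M[R[i]]_k) :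
  0 < d -> (forall v, d * l2norm v <= l2norm (A *m v)) -> A \in unitmx.
Proof.
move=> d0 h; rewrite -unitmx_tr -row_free_unit; apply: inj_row_free => v vA.
apply: trmx_inj; rewrite trmx0; apply: l2norm_eq0.
have Av : A *m v^T = 0 by apply: trmx_inj; rewrite trmx_mul trmxK vA trmx0.
have l0 : l2norm (0 : 'cV[R[i]]_k) = 0.
  rewrite /l2norm big1 ?sqrtr0// => i _.
  by rewrite mxE /cabs ComplexField.Normc.normc0 expr0n.
have := h v^T; rewrite Av l0 pmulr_rle0// => vle0.
by apply/eqP; rewrite eq_le vle0 sqrtr_ge0.
Qed.

(** The lower bound is applied to the vector [invmx A *m v]. *)
Lemma opnorm_invmx_le (R : realType) (k : nat) (d : R) (A : 'M[R[i]]_k) :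
  0 < d -> (forall v, d * l2norm v <= l2norm (A *m v)) ->
  (opnorm (invmx A) <= (d^-1)%:E)%E.
Proof.
move=> d0 h; apply: ge_ereal_sup => _ [v /= v1 <-]; rewrite lee_fin.
rewrite -(ler_pM2l d0) divff ?gt_eqF//; apply: (le_trans (h _)).
by rewrite mulKVmx// (unitmx_of_lower_bound _ _ _ _ d0).
Qed.

(** * The linear system in coordinates *)

Lemma colvec_sum (R : realType) (I : finType) (F : I -> R[i]) :
  \sum_(i < #|I|) F (enum_val i) = \sum_m F m.
Proof. by rewrite -big_enum_val. Qed.

(** Translation invariance removes the origin; homogeneity of degree -2 yields [N ^+ 2], which
    cancels the mesh factor of the system. *)
Lemma kern_gridpt (R : realType) (a : nat -> R * R) (N : nat)
    (m n : int * int) : (0 < N)%N ->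
  kern (gridpt a N m) (gridpt a N n) = N%:R ^+ 2 *
    ((m.1 - n.1)%:~R * (m.2 - n.2)%:~R
     / ((m.1 - n.1)%:~R ^+ 2 + (m.2 - n.2)%:~R ^+ 2) ^+ 2).
Proof.
move=> N0; have NR : N%:R != 0 :> R by rewrite pnatr_eq0 -lt0n.
rewrite /kern /gridpt /euclid_norm /= (_ : 4 = 2 * 2)%N// exprM.
rewrite sqr_sqrtr ?addr_ge0 ?sqr_ge0// !intrB.
have e (c x y : R) : c + x / N%:R - (c + y / N%:R) = (x - y) / N%:R by field.
rewrite !e.
move: (m.1%:~R - n.1%:~R : R) (m.2%:~R - n.2%:~R : R) => x y.
rewrite !expr_div_n -mulrDl.
have [->|h] := eqVneq (x ^+ 2 + y ^+ 2) 0;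
  first by rewrite mul0r !expr0n /= invr0 !mulr0.
by field; rewrite NR h.
Qed.

Section system.
Variables (R : realType) (Omega : set (R * R)) (a : nat -> R * R) (N : nat).
Hypothesis N_gt0 : (0 < N)%N.

(** No case distinction on the diagonal: the numerator vanishes there. *)
Definition real_Tmat : 'M[R]_#|{: omega Omega a N}| := \matrix_(i, j)
  let d1 : R := ((val (enum_val i)).1 - (val (enum_val j)).1)%:~R in
  let d2 : R := ((val (enum_val i)).2 - (val (enum_val j)).2)%:~R in
  - pi^-1 * (d1 * d2 / (d1 ^+ 2 + d2 ^+ 2) ^+ 2).

Lemma TmatE : Tmat Omega a N = map_mx (real_complex R) real_Tmat.
Proof.
apply/matrixP => i j; rewrite !mxE /=.
case: ifP => [/eqP ->|_]; first by rewrite !subrr !mul0r mulr0.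
rewrite kern_gridpt//; congr (real_complex R _).
have NR : N%:R != 0 :> R by rewrite pnatr_eq0 -lt0n.
move: (N%:R ^+ 2) (expf_neq0 2 NR) (_ / _ ^+ 2) => n2 n20 w.
by rewrite invfM !mulNr -mulrA mulKf.
Qed.

Lemma real_Tmat_sym i j : real_Tmat i j = real_Tmat j i.
Proof.
rewrite !mxE /= -[_ - (val (enum_val j)).1]opprB -[_ - (val (enum_val j)).2]opprB.
by rewrite !intrN mulrNN !sqrrN.
Qed.

Lemma real_Tmat_bound (x : 'I_#|{: omega Omega a N}| -> R) :
  `|\sum_i \sum_j real_Tmat i j * (x i * x j)| <= 2^-1 * \sum_i x i ^+ 2.
Proof.
have p0 := pi_gt0 R.
have := @lattice_form_bound R _
  (fun i : 'I_#|{: omega Omega a N}| => val (enum_val i)) x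
  (inj_comp val_inj enum_val_inj).
set Q := \sum_m _ => QB.
have -> : \sum_i \sum_j real_Tmat i j * (x i * x j) = - pi^-1 * Q.
  rewrite /Q mulr_sumr; apply: eq_bigr => i _; rewrite mulr_sumr.
  by apply: eq_bigr => j _; rewrite mxE -[LHS]mulrA.
rewrite normrM normrN normfV (gtr0_norm p0) ler_pdivrMl// mulrA.
exact: QB.
Qed.

Lemma is_solutionE (lambda : R[i]) (f : R * R -> R[i])
    (u : {ffun omega Omega a N -> R[i]}) :
  is_solution lambda f u <->
  (lambda%:M - Tmat Omega a N) *m colvec u
  = colvec (fun m : omega Omega a N => f (gridpt a N (val m))).
Proof.
have E i : ((lambda%:M - Tmat Omega a N) *m colvec u) i 0 =
    lambda * u (enum_val i) + (pi^-1 * N%:R ^- 2)%:C%C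
      * (\sum_(n : omega Omega a N | n != enum_val i)
           (kern (gridpt a N (val (enum_val i))) (gridpt a N (val n)))%:C%C * u n).
  rewrite mulmxBl mul_scalar_mx !mxE; congr (_ + _).
  (* [F] moves the sum from matrix indices to lattice points, where the zero diagonal term is split
     off; the minus sign in [Tmat] becomes the plus sign of the system. *)
  pose F (n : omega Omega a N) := (if enum_val i == n then 0 else
     (- (pi * N%:R ^+ 2)^-1 *
        kern (gridpt a N (val (enum_val i))) (gridpt a N (val n)))%:C%C) * u n.
  rewrite (eq_bigr (fun j => F (enum_val j))); last by move=> j _; rewrite !mxE.
  rewrite (@colvec_sum R _ F) mulr_sumr (bigD1 (enum_val i))//= /F eqxx mul0r add0r.
  rewrite -sumrN; apply: eq_bigr => n ni; rewrite eq_sym (negbTE ni).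
  rewrite mulrA -rmorphM -mulNr -rmorphN; congr (real_complex R _ * _).
  by rewrite invfM; ring.
split=> [h|h m].
  by apply/matrixP => i j; rewrite ord1 E h mxE.
have := congr1 (fun w : 'cV_(_) => w (enum_rank m) 0) h.
by rewrite E mxE enum_rankK.
Qed.

End system.

Theorem corollary3p7 (R : realType) (Omega : set (R * R))
    (Omega_domain : is_domain Omega) (Omega_bounded : bounded_set Omega)
    (lambda : R[i]) (lambda_notin : ~ segC R lambda)
    (a : nat -> R * R) (N : nat) (N_gt0 : (0 < N)%N)
    (omega_neq0 : lattice Omega a N !=set0) :
  (forall f : R * R -> R[i],
     (exists! u : {ffun omega Omega a N -> R[i]}, is_solution lambda f u)
     /\ (forall u : {ffun omega Omega a N -> R[i]},
           is_solution lambda f u <->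
           (lambda%:M - Tmat Omega a N) *m colvec u
           = colvec (fun m : omega Omega a N => f (gridpt a N (val m)))))
  /\ lambda%:M - Tmat Omega a N \in unitmx
  /\ (opnorm (invmx (lambda%:M - Tmat Omega a N))
      <= ((cdist lambda (segC R))^-1)%:E)%E.

Proof.
set A := lambda%:M - Tmat Omega a N.
have d0 := cdist_segC_gt0 R lambda lambda_notin.
have lower v : cdist lambda (segC R) * l2norm v <= l2norm (A *m v).
  rewrite /A TmatE//; apply: resolvent_lower_bound.
    exact: real_Tmat_sym.
  exact: real_Tmat_bound.
have Aunit : A \in unitmx := unitmx_of_lower_bound R _ _ A d0 lower.
split; last by split=> //; exact: opnorm_invmx_le.
move=> f; split; last by move=> u; exact: is_solutionE.
pose F := colvec (fun m : omega Omega a N => f (gridpt a N (val m))).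
exists [ffun m => (invmx A *m F) (enum_rank m) 0]; split.
  apply/is_solutionE; rewrite -/A -/F -[RHS](mulKVmx Aunit F); congr (_ *m _).
  by apply/matrixP => i j; rewrite ord1 !mxE ffunE enum_valK mxE.
move=> u /is_solutionE; rewrite -/A -/F => <-.
by apply/ffunP => m; rewrite ffunE mulKmx// mxE enum_rankK.
Qed.
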